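(* Let $p>0$, $q>d$, $\gamma>0$, $\beta,\eta\in\partial\mathbb{D}$, $x\in\mathbb{T}^d$, $\omega\in\mathbb{T}^d(p,q)$, $z\in\partial\mathbb{D}$ with $L(\omega,z)>\gamma>0$, and let $\tau,\nu$ be the LDT exponents described in the context. There exist a constant $C>0$ and $N=N(p,q,z,\gamma)$ such that if $n\ge N$ and $$\big\|(\mathcal{E}^{\beta,\eta}_{[0,n-1]}(\omega,x)-z)^{-1}\big\|\le C\exp(n^{\nu/2}),$$ then $$\log|\varphi^{\beta,\eta}_{[0,n-1]}(\omega,z;x)|>nL_n(\omega,z)-n^{1-\tau/2}.$$
   Context: Setting. $\mathbb{D}=\{|z|<1\}$, $\partial\mathbb{D}=\{|z|=1\}$, $\mathbb{T}=\mathbb{R}/\mathbb{Z}$, $d>1$ an integer, $h>0$. An analytic function $\alpha:\mathbb{T}^d\to\mathbb{D}$ is fixed, with $\int_{\mathbb{T}^d}\log(1-|\alpha(x)|)\,dx>-\infty$ and a complex analytic extension to $\{x+iy:x\in\mathbb{T}^d,\ y\in\mathbb{R}^d,\ |y|<h\}$; all constants may depend on $\alpha$ (hence on $d,h$). For a phase $x$ and frequency $\omega$ put $\alpha_n=\alpha(x+n\omega)$, $\rho_n=\rho(x+n\omega)$, $\rho(x)=(1-|\alpha(x)|^2)^{1/2}$. For $p>0,q>d$, $\mathbb{T}^d(p,q)$ is the set of $\omega\in\mathbb{T}^d$ with $\|k\cdot\omega\|\ge p/|k|^q$ for all nonzero $k\in\mathbb{Z}^d$ ($\|\cdot\|$ =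 distance to the nearest integer, $|k|=|k_1|+\dots+|k_d|$). Lyapunov exponent. For $z\in\partial\mathbb{D}$ let $$M(\omega,z;x)=\frac1{\rho(x)}\begin{pmatrix}\sqrt z&-\overline{\alpha}(x)/\sqrt z\\-\alpha(x)\sqrt z&1/\sqrt z\end{pmatrix},$$ $M_n(\omega,z;x)=M(\omega,z;x+(n-1)\omega)\cdots M(\omega,z;x)$, $L_n(\omega,z)=\frac1n\int_{\mathbb{T}^d}\log\|M_n(\omega,z;x)\|dx$, $L(\omega,z)=\lim_nL_n(\omega,z)$. CMV matrices. $\Theta_n=\begin{pmatrix}\overline{\alpha}_n&\rho_n\\\rho_n&-\alpha_n\end{pmatrix}$ acts on coordinates $n,n+1$; $\mathcal{E}=\mathcal{L}\mathcal{M}$ on $\ell^2(\mathbb{Z})$ with $\mathcal{L}=\bigoplus_j\Theta_{2j}$, $\mathcal{M}=\bigoplus_j\Theta_{2j+1}$. For a finite interval $\Lambda=[a,b]\subset\mathbb{Z}$ and $\beta,\eta\in\partial\mathbb{D}$, $\mathcal{E}^{\beta,\eta}_{\Lambda}(\omega,x)$ is the unitary matrix obtained by replacing $\alpha_{a-1}$ by $\beta$ and $\alpha_b$ by $\eta$ (and the corresponding $\rho$'s by $0$) in $\mathcal{E}$ and compressing to $\ell^2([a,b])$. $\varphi^{\beta,\eta}_{\Lambda}(\omega,z;x)=\det(z-\mathcal{E}^{\beta,\eta}_{\Lambda}(\omega,x))$. The norm of the resolvent is $+\infty$ if $z$ is an eigenvalue. LDT exponents. $\tau,\nu\in(0,1)$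 are exponents for which: for $\omega\in\mathbb{T}^d(p,q)$, $z\in\partial\mathbb{D}$, $L(\omega,z)>\gamma>0$ and $n$ large, $\mathrm{mes}\{x\in\mathbb{T}^d:|\log|\varphi^{\beta,\eta}_{[0,n-1]}(\omega,z;x)|-nL_n(\omega,z)|>n^{1-\tau}\}<\exp(-Cn^\nu)$, and $\tau$ is also an exponent for which $\mathrm{mes}\{x:|\log\|M_n(\omega,z;x)\|-nL_n(\omega,z)|>n^{1-\tau}\}<\exp(-C_0n^{\sigma})$ for some $\sigma\in(0,1)$, $C_0>0$. *)

(* Defs.v *)
From HB Require Import structures.
From mathcomp Require Import all_boot all_order all_algebra finmap.
From mathcomp Require Import all_classical all_reals all_analysis.
From mathcomp Require Import summability.
From mathcomp Require Import complex.

Set Implicit Arguments.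
Unset Strict Implicit.
Unset Printing Implicit Defensive.

Import Order.TTheory GRing.Theory Num.Theory.
Import numFieldNormedType.Exports.
Import Normc.

Local Open Scope classical_set_scope.
Local Open Scope ring_scope.
Local Open Scope complex_scope.

(* A function on T^d = (R/Z)^d is a Z^d-periodic function on 'rV[R]_d, and a
   point of T^d is given by any of its representatives.  Haar measure on T^d is
   the d-fold product of the uniform probability on [0, 1]; it lives on d-tuples,
   the type for which the library has a product sigma-algebra. *)
Section torus.
Context {R : realType}.

Definition tuple_cons (d : nat)
    (u : measurableTypeR R * d.-tuple (measurableTypeR R)) :
  d.+1.-tuple (measurableTypeR R) := [tuple of u.1 :: u.2].

Lemma measurable_tuple_cons d : measurable_fun setT (@tuple_cons d).
Proof. by apply: measurable_cons. Qed.

HB.instance Definition _ d :=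
  isMeasurableFun.Build _ _ _ _ (@tuple_cons d) (@measurable_tuple_cons d).

Fixpoint torus_measure (d : nat) :
    probability (d.-tuple (measurableTypeR R)) R :=
  match d with
  | 0 => \d_([tuple] : 0.-tuple (measurableTypeR R))
  | e.+1 => distribution (uniform_prob (@ltr01 R) \x torus_measure e)%E
              (@tuple_cons e)
  end.

Definition row_of_tuple (d : nat) (t : d.-tuple (measurableTypeR R)) :
  'rV[R]_d := \row_i tnth t i.

Definition mes (d : nat) (A : set 'rV[R]_d) : \bar R :=
  torus_measure d [set t | A (row_of_tuple t)].

Definition dist_to_int (t : R) : R := inf (range (fun m : int => `|t - m%:~R|)).

Definition diophantine (d : nat) (p q : R) (omega : 'rV[R]_d) : Prop :=
  forall k : 'rV[int]_d, k != 0 ->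
    p / (\sum_(i < d) `|k ord0 i|)%N%:R `^ q
      <= dist_to_int (\sum_(i < d) (k 0 i)%:~R * omega 0 i).

End torus.

Section sampling.
Context {R : realType} (d : nat).

(* The convergence along finite sets of multi-indices is unconditional, hence
   absolute. *)
Definition analytic_at (F : 'rV[R[i]]_d -> R[i]) (a : 'rV[R[i]]_d) : Prop :=
  exists (c : {ffun 'I_d -> nat} -> R[i]) (r : R), 0 < r /\
    forall w : 'rV[R[i]]_d, (forall i, normc (w 0 i - a 0 i) < r) ->
      partial_sum (fun k : {ffun 'I_d -> nat} =>
        c k * \prod_(i < d) (w 0 i - a 0 i) ^+ k i) @ totally
      --> (F w : R[i]^o).

Definition strip (h : R) : set 'rV[R[i]]_d :=
  [set w | Num.sqrt (\sum_i (complex.Im (w 0 i)) ^+ 2) < h].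

Definition has_analytic_extension (h : R) (alpha : 'rV[R]_d -> R[i]) : Prop :=
  exists F : 'rV[R[i]]_d -> R[i],
    [/\ forall x : 'rV[R]_d, F (map_mx (fun t : R => t%:C) x) = alpha x,
        forall (w : 'rV[R[i]]_d) (k : 'rV[int]_d), strip h w ->
          F (w + map_mx intr k) = F w
      & forall w, strip h w -> analytic_at F w].

Definition sampling_function (h : R) (alpha : 'rV[R]_d -> R[i]) : Prop :=
  [/\ forall (x : 'rV[R]_d) (k : 'rV[int]_d),
        alpha (x + map_mx intr k) = alpha x,
      forall x, normc (alpha x) < 1,
      (-oo < \int[torus_measure d]_t
               (ln (1 - normc (alpha (row_of_tuple t))))%:E)%E
    & has_analytic_extension h alpha].

End sampling.

Section norms.
Context {R : realType}.

Definition vnorm (n : nat) (v : 'cV[R[i]]_n) : R :=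
  Num.sqrt (\sum_i (normc (v i 0)) ^+ 2).

Definition opnorm (n : nat) (A : 'M[R[i]]_n) : R :=
  sup [set vnorm (A *m v) | v in [set v : 'cV[R[i]]_n | vnorm v <= 1]].

Definition resolvent_norm (n : nat) (A : 'M[R[i]]_n) (z : R[i]) : \bar R :=
  if eigenvalue A z then +oo%E else (opnorm (invmx (A - z%:M)))%:E.

Definition mx2 (a b c e : R[i]) : 'M[R[i]]_2 :=
  \matrix_(i, j) if i == 0 then (if j == 0 then a else b)
                 else (if j == 0 then c else e).

End norms.

Section cocycle.
Context {R : realType} (d : nat) (alpha : 'rV[R]_d -> R[i]).

Definition rho (x : 'rV[R]_d) : R := Num.sqrt (1 - (normc (alpha x)) ^+ 2).

(* The branch of the square root is immaterial: the other one changes the sign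
   of the matrix. *)
Definition szego (z : R[i]) (x : 'rV[R]_d) : 'M[R[i]]_2 :=
  ((rho x)^-1)%:C *:
    mx2 (sqrtc z)              (- (conjc (alpha x) / sqrtc z))
        (- (alpha x * sqrtc z)) (sqrtc z)^-1.

Fixpoint transfer (omega : 'rV[R]_d) (z : R[i]) (n : nat) (x : 'rV[R]_d) :
    'M[R[i]]_2 :=
  match n with
  | 0 => 1%:M
  | m.+1 => szego z (x + m%:R *: omega) *m transfer omega z m x
  end.

Definition Ln (omega : 'rV[R]_d) (z : R[i]) (n : nat) : R :=
  n%:R^-1 * \int[torus_measure d]_t
              ln (opnorm (transfer omega z n (row_of_tuple t))).

Definition lyapunov (omega : 'rV[R]_d) (z : R[i]) : R :=
  lim (Ln omega z n @[n --> \oo]).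

End cocycle.

Section CMV.
Context {R : realType}.

Definition Theta (a : R[i]) (r : R) : 'M[R[i]]_2 :=
  mx2 (conjc a) r%:C r%:C (- a).

(* Entry (i, k) of the direct sum over j of Theta_(2j + s), the block Theta_m
   acting on the coordinates m and m + 1. *)
Definition Theta_sum (s : int) (a : int -> R[i]) (r : int -> R) (i k : int) :
    R[i] :=
  let off (l : int) : int := ((l - s) %% 2)%Z in
  let m := i - off i in
  if k - off k == m then
    Theta (a m) (r m) (inord (absz (off i))) (inord (absz (off k)))
  else 0.

(* Entry (i, j) of L M; entry (i, k) of L vanishes unless |i - k| <= 1. *)
Definition cmv (a : int -> R[i]) (r : int -> R) (i j : int) : R[i] :=
  \sum_(k <- [:: i - 1; i; i + 1]) Theta_sum 0 a r i k * Theta_sum 1 a r k j.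

Variables (d : nat) (alpha : 'rV[R]_d -> R[i]).

(* E_[lo, hi]^(beta, eta) with hi = lo + n - 1. *)
Definition cmv_box (beta eta : R[i]) (lo : int) (n : nat)
    (omega x : 'rV[R]_d) : 'M[R[i]]_n :=
  let hi : int := lo + n%:Z - 1 in
  let phase (m : int) := x + m%:~R *: omega in
  let a (m : int) := if m == lo - 1 then beta
                     else if m == hi then eta else alpha (phase m) in
  let r (m : int) := if (m == lo - 1) || (m == hi) then 0
                     else rho alpha (phase m) in
  \matrix_(i, j) cmv a r (lo + i%:Z) (lo + j%:Z).

Definition phi (beta eta : R[i]) (lo : int) (n : nat) (omega : 'rV[R]_d)
    (z : R[i]) (x : 'rV[R]_d) : R[i] :=
  \det (z%:M - cmv_box beta eta lo n omega x).

(* lne and not ln is applied to |phi|, which may vanish: ln 0 = 0 but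
   lne 0 = -oo. *)
Definition LDT_exponents (p q gamma : R) (z : R[i]) (tau nu : R) : Prop :=
  [/\ 0 < tau < 1, 0 < nu < 1,
      exists (C : R) (N : nat), 0 < C /\
        forall omega beta eta, diophantine p q omega ->
          gamma < lyapunov alpha omega z -> normc beta = 1 -> normc eta = 1 ->
        forall n : nat, (N <= n)%N ->
          (mes [set x | (n%:R `^ (1 - tau))%:E <
                 `| lne (normc (phi beta eta 0 n omega z x))%:E
                    - (n%:R * Ln alpha omega z n)%:E |]
           < (expR (- (C * n%:R `^ nu)))%:E)%E
    & exists (sigma C : R) (N : nat), 0 < sigma < 1 /\ 0 < C /\
        forall omega, diophantine p q omega ->
          gamma < lyapunov alpha omega z ->
        forall n : nat, (N <= n)%N ->
          (mes [set x | n%:R `^ (1 - tau) <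
                 `| ln (opnorm (transfer alpha omega z n x))
                    - n%:R * Ln alpha omega z n |]%R
           < (expR (- (C * n%:R `^ sigma)))%:E)%E].

End CMV.

(* Main.v *)
(* The exceptional set of the large deviation estimate has measure less than
   [delta ^ d] with [delta = exp (- C0 n^nu / d)], so it contains no cube of side
   [delta], and some [y] with [|x - y| <= delta] is not exceptional.  Since [alpha] is
   Lipschitz and [rho] is Hoelder of exponent 1/2, the box matrices [E] and [E'] at
   [x] and [y] differ by [O(exp (- C0 n^nu / (2 d)))], which beats the resolvent
   bound [exp (n^(nu/2))].  Hence
     det (z - E') = det (z - E) det (1 + (E - z)^-1 (E' - E)),
   where the last factor is at most [exp 1], and the lower bound for
   [log |det (z - E')|] is passed on to [log |det (z - E)|] with a loss of [1]. *)

Require Import Defs.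
From HB Require Import structures.
From mathcomp Require Import all_boot all_order all_algebra finmap.
From mathcomp Require Import all_classical all_reals all_analysis.
From mathcomp Require Import summability.
From mathcomp Require Import perm complex ring lra.

Set Implicit Arguments.
Unset Strict Implicit.
Unset Printing Implicit Defensive.

Import Order.TTheory GRing.Theory Num.Theory.
Import numFieldNormedType.Exports.
Import Normc.

Local Open Scope classical_set_scope.
Local Open Scope ring_scope.
Local Open Scope complex_scope.

(** * The complex modulus with values in [R], and differences of products *)

Section modulus.
Context {R : realType}.
Implicit Types x y : R[i].

Lemma normcE_norm x : `|x| = (normc x)%:C.
Proof. by case: x. Qed.

Lemma normc_ge0 x : 0 <= normc x.
Proof. by case: x => a b /=; exact: sqrtr_ge0. Qed.

Lemma normc_triangle x y : normc (x + y) <= normc x + normc y.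
Proof. exact: le_normcD. Qed.

Lemma normc_opp x : normc (- x) = normc x.
Proof. exact: normcN. Qed.

Lemma normc_distC x y : normc (x - y) = normc (y - x).
Proof. by rewrite -normc_opp opprB. Qed.

Lemma normc_conj x : normc (conjc x) = normc x.
Proof. by case: x => a b /=; rewrite sqrrN. Qed.

Lemma normc_real (t : R) : normc t%:C = `|t|.
Proof. by rewrite /= expr0n addr0 sqrtr_sqr. Qed.

Lemma normc_sum (I : Type) (s : seq I) (P : pred I) (F : I -> R[i]) :
  normc (\sum_(i <- s | P i) F i) <= \sum_(i <- s | P i) normc (F i).
Proof.
elim/big_ind2: _ => [|a b c e ab ce|//]; first by rewrite normc0.
by rewrite (le_trans (normc_triangle _ _)) ?lerD.
Qed.

Lemma normc_prod (I : Type) (s : seq I) (P : pred I) (F : I -> R[i]) :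
  normc (\prod_(i <- s | P i) F i) = \prod_(i <- s | P i) normc (F i).
Proof.
elim/big_ind2: _ => [|a b c e <- <-|//]; first by rewrite normc1.
by rewrite normcM.
Qed.

Lemma normcX x n : normc (x ^+ n) = normc x ^+ n.
Proof. by elim: n => [|n IH]; rewrite ?expr0 ?normc1 // !exprS normcM IH. Qed.

Lemma normc_dist x y : `|normc x - normc y| <= normc (x - y).
Proof.
have h (u v : R[i]) : normc u - normc v <= normc (u - v).
  by rewrite lerBlDr -{1}(subrK v u) normc_triangle.
by rewrite ler_norml lerNl opprB [normc (x - y)]normc_distC h normc_distC h.
Qed.

(** Telescoping: exchange one factor at a time. The error [e i] is relative to the bound [t i], so
    every exchange leaves the full product of the [t i]; for powers this gives [t ^+ n] rather than
    [t ^+ n.-1]. *)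
Lemma normc_prod_sub (I : Type) (s : seq I) (a b : I -> R[i]) (t e : I -> R) :
  (forall i, normc (a i) <= t i) -> (forall i, normc (b i) <= t i) ->
  (forall i, normc (a i - b i) <= e i * t i) ->
  normc (\prod_(i <- s) a i - \prod_(i <- s) b i) <=
  (\sum_(i <- s) e i) * \prod_(i <- s) t i.
Proof.
move=> at_ bt abe; have t0 i : 0 <= t i by apply: le_trans (at_ i); exact: normc_ge0.
elim: s => [|i s IH]; first by rewrite !big_nil subrr normc0 mul0r.
rewrite !big_cons.
have -> : a i * \prod_(j <- s) a j - b i * \prod_(j <- s) b j =
  a i * (\prod_(j <- s) a j - \prod_(j <- s) b j) +
  (a i - b i) * \prod_(j <- s) b j by ring.
rewrite (le_trans (normc_triangle _ _)) // !normcM mulrDl addrC lerD //.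
  rewrite mulrA ler_pM ?normc_ge0 //.
  by rewrite normc_prod ler_prod // => j _; rewrite normc_ge0 bt.
by rewrite mulrCA ler_pM ?normc_ge0.
Qed.

Lemma normc_expr_sub x y (t e : R) n : normc x <= t -> normc y <= t ->
  normc (x - y) <= e * t -> normc (x ^+ n - y ^+ n) <= n%:R * e * t ^+ n.
Proof.
move=> xt yt xye.
have := @normc_prod_sub nat (iota 0 n) (fun=> x) (fun=> y) (fun=> t) (fun=> e)
  (fun=> xt) (fun=> yt) (fun=> xye).
by rewrite !big_const_seq !count_predT size_iota !iter_mulr_1 iter_addr_0 mulr_natl.
Qed.

End modulus.

(** * A geometric majorant over finite sets of multi-indices *)

Section power_series.
Context {R : realType} (d : nat).
Implicit Types k : {ffun 'I_d -> nat}.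

(** With [N] above all exponents in [A], the set embeds into the box of maps ['I_d -> 'I_N], over
    which the sum factors into [d] geometric sums, each at most 2. *)
Lemma sum_half_powers_le (A : {fset {ffun 'I_d -> nat}}) :
  \sum_(k <- A) \prod_i (2^-1 : R) ^+ k i <= 2 ^+ d.
Proof.
pose N := (\max_(k <- A) \max_i k i).+1.
pose f (k : {ffun 'I_d -> nat}) : {ffun 'I_d -> 'I_N} := [ffun i => inord (k i)].
have fK k : k \in A -> forall i, nat_of_ord (f k i) = k i.
  move=> kA i; rewrite ffunE inordK // ltnS.
  by rewrite (leq_trans _ (leq_bigmax_seq _ kA _)) // (@leq_bigmax _ (fun j : 'I_d => k j) i).
have -> : \sum_(k <- A) \prod_i (2^-1 : R) ^+ k i =
   \sum_(g : {ffun 'I_d -> 'I_N}) \sum_(k <- A | f k == g) \prod_i 2^-1 ^+ k i.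
  rewrite (exchange_big_dep predT) //=.
  by apply: eq_bigr => k _; rewrite (big_pred1 (f k)) // => g; rewrite eq_sym.
apply: (@le_trans _ _ (\sum_(g : {ffun 'I_d -> 'I_N}) \prod_i (2^-1 : R) ^+ g i)).
  apply: ler_sum => g _.
  rewrite big_seq_cond.
  have [/hasP[k0 k0A /eqP k0g]|nog] := boolP (has (fun k => f k == g) A); last first.
    rewrite big1 => [|k /andP[kA kg]]; last by case/hasP: nog; exists k.
    by rewrite prodr_ge0 // => i _; rewrite exprn_ge0 // invr_ge0.
  rewrite (eq_bigl (pred1 k0)) => [|k].
    rewrite -big_filter filter_pred1_uniq ?fset_uniq // big_seq1.
    by rewrite le_eqVlt; apply/orP; left; apply/eqP; apply: eq_bigr => i _; rewrite -k0g fK.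
  apply/andP/eqP => [[kA /eqP kg]|->]; last by rewrite k0A k0g.
  by apply/ffunP => i; rewrite -(fK _ kA) -(fK _ k0A) kg k0g.
rewrite -(bigA_distr_bigA (fun _ (j : 'I_N) => (2^-1 : R) ^+ j)) /=.
rewrite -[in leRHS](card_ord d) -prodr_const ler_prod // => i _.
rewrite sumr_ge0 => [/=|j _]; last by rewrite exprn_ge0 // invr_ge0.
have : (1 - 2^-1 : R) * (\sum_(j < N) 2^-1 ^+ j) <= 1.
  by rewrite -opprB mulNr -subrX1 opprB lerBlDr lerDl exprn_ge0 // invr_ge0.
lra.
Qed.

End power_series.

(** * Local Lipschitz bounds for sums of power series *)

Section power_series_lipschitz.
Context {R : realType} (d : nat).
Implicit Types k : {ffun 'I_d -> nat}.

Lemma cvg_totally_sum (I : choiceType) (x : I -> R[i]) (l : R[i]) (e : R) :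
  partial_sum x @ totally --> (l : R[i]^o) -> 0 < e ->
  exists A0 : {fset I}, forall A : {fset I}, (A0 `<=` A)%fset ->
    normc (\sum_(k <- A) x k - l) < e.
Proof.
move=> xl e0.
have eC : (0 : R[i]) < e%:C by rewrite ltcR.
have FF := @totally_filter I.
have [A0 _ A0P] := (@cvgrPdist_lt R[i] (R[i]^o) _ totally _ (partial_sum x) l).1 xl _ eC.
exists A0 => A /A0P /=.
by rewrite /partial_sum big_seq_fsetE /= normcE_norm ltcR normc_distC.
Qed.

(** Outside [A0] a term is the difference of two partial sums, over [A0] with and without its index,
    both within 1 of the limit; inside [A0] the finite sum of moduli dominates it. *)
Lemma cvg_totally_bounded (I : choiceType) (x : I -> R[i]) (l : R[i]) :
  partial_sum x @ totally --> (l : R[i]^o) ->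
  exists B : R, 0 <= B /\ forall j : I, normc (x j) <= B.
Proof.
move=> /cvg_totally_sum /(_ (@ltr01 R))[A0 A0P].
have S0 : 0 <= \sum_(k <- A0) normc (x k) by rewrite sumr_ge0 // => k _; exact: normc_ge0.
exists (2 + \sum_(k <- A0) normc (x k)); split; first by rewrite addr_ge0.
move=> k; have [kA|kA] := boolP (k \in A0).
  rewrite (big_fsetD1 k) //= addrCA lerDl addr_ge0 // sumr_ge0 // => j _.
  exact: normc_ge0.
have h1 := A0P _ (fsubset_refl _); have := A0P _ (fsubsetU1 k A0).
rewrite big_fsetU1 //= => h2.
set S := \sum_(j <- A0) x j in h1 h2.
have -> : x k = (x k + S - l) - (S - l) by ring.
apply: (le_trans (normc_triangle _ _)); rewrite normc_opp; lra.
Qed.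

Lemma analytic_at_lipschitz (F : 'rV[R[i]]_d -> R[i]) a : analytic_at F a ->
  exists (r L : R), [/\ 0 < r, 0 <= L & forall (w v : 'rV[R[i]]_d) (delta : R), 0 <= delta ->
    (forall i, normc (w 0 i - a 0 i) <= r) ->
    (forall i, normc (v 0 i - a 0 i) <= r) ->
    (forall i, normc (w 0 i - v 0 i) <= delta) ->
    normc (F w - F v) <= L * delta].
Proof.
move=> [c [r [r0 cF]]].
(* Coefficients are bounded by [B (4 t)^-|k|], and [|k| <= 2^|k|], so on the
   polydisc of radius [t] the difference quotients are dominated by [2^-|k|]. *)
have [t [t0 rt]] : exists t : R, 0 < t /\ r = 8 * t.
  by exists (r / 8); rewrite divr_gt0 //; split=> //; lra.
have [B [B0 cB]] : exists B : R, 0 <= B /\ forall k,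
    normc (c k) * \prod_i (4 * t) ^+ k i <= B.
  (* The series converges at the point displaced by [4 * t < r] in every coordinate, so its terms
     there are bounded: a Cauchy estimate without contour integrals. *)
  have /cF/cvg_totally_bounded[B [B0 HB]] :
      forall i, normc ((\row_j (a 0 j + (4 * t)%:C)) 0 i - a 0 i) < r.
    by move=> i; rewrite mxE addrAC subrr add0r normc_real ger0_norm; lra.
  exists B; split=> // k; have := HB k; rewrite normcM normc_prod.
  rewrite (eq_bigr (fun i => (4 * t) ^+ k i)) // => i _.
  by rewrite mxE addrAC subrr add0r normcX normc_real ger0_norm // mulr_ge0 // ltW.
exists t, (B / t * 2 ^+ d); split=> //; first by rewrite mulr_ge0 ?exprn_ge0 // divr_ge0 // ltW.
move=> w v delta delta0 wa va wv.
have tr : t < r by lra.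
have cw := cF w (fun i => le_lt_trans (wa i) tr).
have cv := cF v (fun i => le_lt_trans (va i) tr).
apply/ler_addgt0Pr => e e0.
have e20 : 0 < e / 2 by rewrite divr_gt0.
have [A1 A1P] := cvg_totally_sum cw e20.
have [A2 A2P] := cvg_totally_sum cv e20.
have := A1P _ (fsubsetUl A1 A2); have := A2P _ (fsubsetUr A1 A2).
(* One finite set serves both points, so only the finite sums need a Lipschitz bound, uniform in
   [A]. *)
set A := (A1 `|` A2)%fset; set Sv := \sum_(k <- A) _; set Sw := \sum_(k <- A) _.
move=> hv hw.
suff hS : normc (Sw - Sv) <= B / t * 2 ^+ d * delta.
  have -> : F w - F v = (Sw - Sv) + ((Sv - F v) - (Sw - F w)) by ring.
  apply: (le_trans (normc_triangle _ _)).
  have := normc_triangle (Sv - F v) (- (Sw - F w)); rewrite normc_opp; lra.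
rewrite /Sw /Sv -sumrB; apply: (le_trans (normc_sum _ _ _)).
apply: (@le_trans _ _ (\sum_(k <- A) (B / t * delta) * \prod_i (2^-1 : R) ^+ k i)).
  apply: ler_sum => k _; rewrite -mulrBr normcM.
  have hp : normc (\prod_i (w 0 i - a 0 i) ^+ k i - \prod_i (v 0 i - a 0 i) ^+ k i)
     <= (\sum_i (k i)%:R * (delta / t)) * \prod_i t ^+ k i.
    have hX (u : 'rV[R[i]]_d) i : normc (u 0 i - a 0 i) <= t ->
       normc ((u 0 i - a 0 i) ^+ k i) <= t ^+ k i.
      by move=> h; rewrite normcX lerXn2r // nnegrE ?normc_ge0 // ltW.
    apply: normc_prod_sub => i; [exact: hX|exact: hX|].
    apply: normc_expr_sub => //; rewrite divfK ?gt_eqF //.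
    by rewrite opprB addrA subrK.
  rewrite (le_trans (ler_wpM2l (normc_ge0 _) hp)) //.
  rewrite -mulr_suml -natr_sum.
  have kle : (\sum_i k i)%:R <= \prod_i (2 : R) ^+ k i.
    by rewrite prodrXr -natrX ler_nat ltnW // ltn_expl.
  have -> : B / t * delta * \prod_i (2^-1 : R) ^+ k i =
     \prod_i (2 : R) ^+ k i * (B * (delta / t)) * \prod_i (4^-1 : R) ^+ k i.
    have -> : \prod_i (2^-1 : R) ^+ k i = \prod_i (2 : R) ^+ k i * \prod_i (4^-1 : R) ^+ k i.
      rewrite -big_split /=; apply: eq_bigr => i _; rewrite -exprMn; congr (_ ^+ _); lra.
    ring.
  have -> : \prod_i t ^+ k i = \prod_i (4 * t) ^+ k i * \prod_i (4^-1 : R) ^+ k i.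
    rewrite -big_split /=; apply: eq_bigr => i _; rewrite -exprMn; congr (_ ^+ _); lra.
  have q0 : 0 <= \prod_i (4^-1 : R) ^+ k i.
    by rewrite prodr_ge0 // => i _; rewrite exprn_ge0 // invr_ge0.
  rewrite !mulrA ler_wpM2r //.
  rewrite [leLHS](_ : _ = (\sum_i k i)%:R *
    (normc (c k) * \prod_i (4 * t) ^+ k i) * (delta / t)); last ring.
  have dt0 : 0 <= delta / t by rewrite divr_ge0 // ltW.
  have ct0 : 0 <= normc (c k) * \prod_i (4 * t) ^+ k i.
    by rewrite mulr_ge0 ?normc_ge0 // prodr_ge0 // => i _; rewrite exprn_ge0 // mulr_ge0 // ltW.
  by apply: (le_trans (ler_wpM2r dt0 (ler_pM (ler0n _ _) ct0 kle (cB k)))); rewrite !mulrA.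
rewrite -mulr_sumr [leRHS]mulrAC ler_wpM2l ?sum_half_powers_le //.
by rewrite !mulr_ge0 ?invr_ge0 // ltW.
Qed.

End power_series_lipschitz.

(** * Uniform Lipschitz continuity of the sampling function on the torus *)

Section sampling_lipschitz.
Context {R : realType} (d : nat).

Lemma periodic_unit_cube (x : 'rV[R]_d) : exists k : 'rV[int]_d,
  forall i, 0 <= (x + map_mx intr k) 0 i < 1.
Proof.
exists (\row_i - Num.floor (x 0 i)) => i.
rewrite !mxE rmorphN /= subr_ge0 ltrBlDl.
by rewrite floor_le /= -[1]/(1%:~R) -rmorphD /= floorD1_gt.
Qed.

Lemma analytic_extension_lipschitz (h : R) (alpha : 'rV[R]_d -> R[i]) :
  0 < h -> has_analytic_extension h alpha ->
  (forall x (k : 'rV[int]_d), alpha (x + map_mx intr k) = alpha x) ->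
  exists (r L : R), [/\ 0 < r, 0 <= L & forall (x y : 'rV[R]_d) (delta : R),
    0 <= delta <= r -> (forall i, `|x 0 i - y 0 i| <= delta) ->
    normc (alpha x - alpha y) <= L * delta].
Proof.
move=> h0 [F [Falpha _ Fan]] alphaper.
(* A single [N] is both the Lipschitz constant and the inverse radius, so local bounds become a
   property holding for large [N] near each point, which compactness of the cube makes uniform. *)
pose P (N : nat) (x : 'rV[R]_d) := forall (y : 'rV[R]_d) (delta : R),
  0 <= delta <= N.+1%:R^-1 -> (forall i, `|x 0 i - y 0 i| <= delta) ->
  normc (alpha x - alpha y) <= N%:R * delta.
pose emb := map_mx (fun t : R => t%:C) : 'rV[R]_d -> 'rV[R[i]]_d.
have embB (u v : 'rV[R]_d) i : normc (emb u 0 i - emb v 0 i) = `|u 0 i - v 0 i|.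
  by rewrite !mxE -rmorphB normc_real.
(* Half of [r] is spent on moving the centre to [x'], half on the step from [x'] to [y]. *)
have loc (x x' : 'rV[R]_d) (r L : R) N : 0 < r -> L <= N%:R ->
    N.+1%:R^-1 <= r / 2 -> (forall i, `|x' 0 i - x 0 i| <= r / 2) ->
    (forall (w v : 'rV[R[i]]_d) (delta : R), 0 <= delta ->
      (forall i, normc (w 0 i - emb x 0 i) <= r) ->
      (forall i, normc (v 0 i - emb x 0 i) <= r) ->
      (forall i, normc (w 0 i - v 0 i) <= delta) ->
      normc (F w - F v) <= L * delta) -> P N x'.
  move=> r0 LN Nr xx' FL y delta /andP[delta0 deltaN] xy.
  apply: (@le_trans _ _ (L * delta)); last by rewrite ler_wpM2r.
  rewrite -!Falpha; apply: FL => // i; rewrite embB //.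
    by have := xx' i; lra.
  have -> : y 0 i - x 0 i = (x' 0 i - x 0 i) - (x' 0 i - y 0 i) by ring.
  rewrite (le_trans (ler_normB _ _)) // (splitr r) lerD ?xx' //.
  exact: le_trans (xy i) (le_trans deltaN Nr).
pose K := [set v : 'rV[R]_d | forall i, v ord0 i \in `[0, 1]].
have Kc : compact K.
  apply: (@rV_compact _ _ (fun=> `[(0 : R), 1]%classic)) => _.
  exact: segment_compact.
have [] := (compact_near_coveringP K).1 Kc nat \oo P _.
  move=> x _.
  have sx : strip h (emb x).
    by rewrite /strip /= big1 ?sqrtr0 // => i _; rewrite mxE /= expr0n.
  have [r [L [r0 L0 FL]]] := analytic_at_lipschitz (Fan _ sx).
  have r20 : 0 < r / 2 by rewrite divr_gt0.
  near=> x' N.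
  apply: (@loc x x' r L N) => //.
  - by near: N; exact: nbhs_infty_ger.
  - by near: N; apply: filterS (near_infty_natSinv_lt (PosNum r20)) => n /= /ltW.
  - have [] : ball x (r / 2) x' by near: x'; exact: nbhsx_ballx.
    by move=> _ xx' i; have := xx' 0 i; rewrite /ball /= distrC => /ltW.
move=> N _ /(_ N (leqnn N)) KP.
exists N.+1%:R^-1, N%:R; split; rewrite ?invr_gt0 //.
move=> x y delta deltaN xy.
(* Both points are translated by the same integer vector; only the first has to land in the cube. *)
have [k xk] := periodic_unit_cube x.
rewrite -(alphaper x k) -(alphaper y k); apply: KP => //.
  by move=> i; have /andP[? /ltW ?] := xk i; rewrite /= in_itv /=; apply/andP.
by move=> i; rewrite !mxE opprD addrACA subrr addr0; exact: xy.
Unshelve. all: end_near.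
Qed.
End sampling_lipschitz.

(** * Measure of small cubes and points outside a set of small measure *)

Section torus_measure.
Context {R : realType}.

Lemma ge0_le_integral_any {dT} {T : measurableType dT}
    (mu : {measure set T -> \bar R}) (f g : T -> \bar R) :
  (forall x, 0 <= f x)%E -> (forall x, f x <= g x)%E ->
  (\int[mu]_x f x <= \int[mu]_x g x)%E.
Proof.
move=> f0 fg; have g0 x : (0 <= g x)%E := le_trans (f0 x) (fg x).
rewrite !ge0_integralTE //.
apply: ge_ereal_sup => _ [k kf <-]; apply: ereal_sup_ubound.
by exists k => // x; exact: le_trans (kf x) (fg x).
Qed.

(* [torus_measure] is an iterated integral, and integrals are suprema over simple
   functions: monotonicity needs no measurability. *)
Lemma le_torus_measure d (A B : set (d.-tuple (measurableTypeR R))) :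
  A `<=` B -> (torus_measure d A <= torus_measure d B)%E.
Proof.
elim: d A B => [|d IH] A B AB.
  rewrite /= /dirac !indicE lee_fin ler_nat.
  by case: (boolP (_ \in A)) => // /set_mem/AB/mem_set ->.
apply: ge0_le_integral_any => x; first exact: measure_ge0.
by apply: IH => t; rewrite /xsection /= !inE => /AB.
Qed.

Lemma uniform_prob_itv (a b : R) : 0 <= a -> a <= b -> b <= 1 ->
  uniform_prob (@ltr01 R) `[a, b]%classic = (b - a)%:E.
Proof.
move=> a0 ab b1.
rewrite /uniform_prob integral_uniform_pdf.
have -> : `[a, b]%classic `&` `[0, 1]%classic = `[a, b]%classic :> set R.
  apply/seteqP; split=> x /=; first by case.
  rewrite !in_itv /= => /andP[ax xb]; split; first by rewrite ax.
  by rewrite (le_trans a0 ax) (le_trans xb b1).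
rewrite (eq_integral (fun=> 1%E)) => [|x].
  rewrite integral_cst //= mul1e.
  rewrite lebesgue_measure_itv /= lte_fin; case: ltP => [//|ba].
  by rewrite (@le_anti _ _ a b) ?subrr // ab.
rewrite inE /= in_itv /= => /andP[ax xb].
by rewrite /uniform_pdf (le_trans a0 ax) (le_trans xb b1) /= subr0 invr1.
Qed.

Lemma measurable_box d (u : 'I_d -> R) (delta : R) :
  measurable [set t : d.-tuple (measurableTypeR R) |
    forall i, u i <= tnth t i <= u i + delta].
Proof.
rewrite (_ : mkset _ = \bigcap_(i in [set: 'I_d])
    ((fun t : d.-tuple (measurableTypeR R) => tnth t i) @^-1` `[u i, u i + delta]%classic)).
  apply: fin_bigcap_measurable => [|i _]; first exact: finite_finset.
  rewrite -[X in measurable X]setTI.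
  exact: (measurable_tnth i measurableT (@measurable_itv R _)).
apply/seteqP; split=> t /= h i; [move=> _|]; have := h i; rewrite /= in_itv //=; exact.
Qed.

(** Induction on [d]: under [tuple_cons] the cube pulls back to its first side times a cube of one
    dimension less. *)
Lemma torus_measure_box d (u : 'I_d -> R) (delta : R) : 0 <= delta ->
  (forall i, 0 <= u i /\ u i + delta <= 1) ->
  torus_measure d [set t | forall i, u i <= tnth t i <= u i + delta] =
  (delta ^+ d)%:E.
Proof.
move=> delta0; elim: d u => [|d IH] u u01.
  by rewrite /= /dirac indicE mem_set //= => -[].
rewrite /= /distribution /pushforward.
rewrite (_ : _ @^-1` _ = `[u ord0, u ord0 + delta]%classic `*`
  [set t | forall i, u (lift ord0 i) <= tnth t i <= u (lift ord0 i) + delta]).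
  have [u0 u1] := u01 ord0.
  have U : uniform_prob (@ltr01 R) `[u ord0, u ord0 + delta]%classic = delta%:E.
    by rewrite uniform_prob_itv ?lerDl // addrAC subrr add0r.
  rewrite product_measure1E //; last exact: measurable_box.
  rewrite exprS EFinM -U; congr (_ * _)%E.
  by apply: (IH (fun i => u (lift ord0 i))) => i; exact: u01.
apply: funext => -[a t]; apply: propext; rewrite /= in_itv /=; split.
  move=> h; split; first by have := h ord0; rewrite tnth0.
  by move=> i; have := h (lift ord0 i); rewrite tnthS.
move=> [h0 h] i; have [j ->|->] := unliftP ord0 i; first by rewrite tnthS.
by rewrite tnth0.
Qed.

Lemma exists_near_notin d (A : set 'rV[R]_d) (x : 'rV[R]_d) (delta : R) :
  0 <= delta <= 2^-1 -> (forall i, 0 <= x 0 i < 1) ->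
  (mes A < (delta ^+ d)%:E)%E ->
  exists y : 'rV[R]_d, ~ A y /\ forall i, `|x 0 i - y 0 i| <= delta.
Proof.
move=> /andP[delta0 delta1] x01 Adelta; apply: contrapT => noy.
(* The cube has [x] as a corner and extends towards the middle of [[0, 1]] in each coordinate, so
   for [delta <= 2^-1] it stays inside the unit cube. *)
pose u i := if x 0 i <= 2^-1 then x 0 i else x 0 i - delta.
suff : (mes A >= (delta ^+ d)%:E)%E by rewrite leNgt Adelta.
rewrite -(@torus_measure_box d u) //; last first.
  by move=> i; rewrite /u; have /andP[x0 x1] := x01 i; case: (lerP (x 0 i)) => ?; split; lra.
apply: le_torus_measure => t ut /=; apply: contrapT => nA; apply: noy.
exists (row_of_tuple t); split=> // i; rewrite mxE ler_norml.
by have /andP[] := ut i; rewrite /u; case: (lerP (x 0 i)) => _ ? ?; apply/andP; split; lra.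
Qed.

End torus_measure.

(** * Determinants under a perturbation controlled by the resolvent *)

Section determinant.
Context {R : realType}.

(** The product of row sums expands over all maps of ['I_n] to itself; the injective ones give the
    Leibniz terms and the others are nonnegative. *)
Lemma normc_det_le n (M : 'M[R[i]]_n) :
  normc (\det M) <= \prod_i \sum_j normc (M i j).
Proof.
rewrite bigA_distr_bigA /= (bigID (fun f : {ffun 'I_n -> 'I_n} => injectiveb f)) /=.
rewrite ler_wpDr //.
  by rewrite sumr_ge0 // => f _; rewrite prodr_ge0 // => i _; exact: normc_ge0.
rewrite (reindex (@pval _)) /=; last first.
  by exists (insubd (1%g : 'S_n)) => /= f Uf; first apply: val_inj; apply: insubdK.
apply: (le_trans (normc_sum _ _ _)).
rewrite (eq_bigl predT) => [|s]; last exact: (valP s).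
apply: ler_sum => s _; rewrite normcM normcX normc_opp normc1 expr1n mul1r.
by rewrite normc_prod le_eqVlt; apply/orP; left; apply/eqP; apply: eq_bigr => i _; rewrite pvalE.
Qed.

Lemma vnorm_delta n (j : 'I_n) : vnorm (delta_mx j 0 : 'cV[R[i]]_n) = 1.
Proof.
rewrite /vnorm (bigD1 j) //= big1 ?addr0 => [|i ij].
  by rewrite !mxE !eqxx normc1 expr1n sqrtr1.
by rewrite !mxE (negPf ij) normc0 expr0n.
Qed.

Lemma normc_le_vnorm n (v : 'cV[R[i]]_n) i : normc (v i 0) <= vnorm v.
Proof.
rewrite -[leLHS]ger0_norm ?normc_ge0 // -sqrtr_sqr ler_wsqrtr //.
by rewrite (bigD1 i) //= lerDl sumr_ge0 // => j _; exact: sqr_ge0.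
Qed.

Lemma vnorm_le_sum n (v : 'cV[R[i]]_n) : vnorm v <= \sum_i normc (v i 0).
Proof.
have s0 : 0 <= \sum_i normc (v i 0) by rewrite sumr_ge0 // => i _; exact: normc_ge0.
rewrite -[leRHS]ger0_norm // -sqrtr_sqr ler_wsqrtr // expr2 mulr_suml.
apply: ler_sum => i _; rewrite expr2 ler_wpM2l ?normc_ge0 //.
by rewrite (bigD1 i) //= lerDl sumr_ge0 // => j _; exact: normc_ge0.
Qed.

Lemma normc_entry_le_opnorm n (A : 'M[R[i]]_n) i j : normc (A i j) <= opnorm A.
Proof.
have Aij : vnorm (A *m delta_mx j 0) <= opnorm A.
  apply: ub_le_sup; last by exists (delta_mx j 0) => //=; rewrite vnorm_delta.
  (* A value lies below [sup] only if the set is bounded above, so an explicit bound on the unit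
     ball is supplied. *)
  exists (\sum_k \sum_l normc (A k l)) => _ [v v1 <-].
  apply: (le_trans (vnorm_le_sum _)); apply: ler_sum => k _.
  rewrite mxE; apply: (le_trans (normc_sum _ _ _)); apply: ler_sum => l _.
  rewrite normcM ler_piMr ?normc_ge0 //.
  exact: le_trans (normc_le_vnorm _ _) v1.
apply: le_trans Aij; apply: le_trans (normc_le_vnorm _ i).
by rewrite -colE !mxE.
Qed.

(* [z - A' = (z - A) (1 + (A - z)^-1 (A' - A))], and the second factor has row
   sums at most [1 + n^2 kappa B]. *)
Lemma det_resolvent_perturb n (A A' : 'M[R[i]]_n) (z : R[i]) (kappa B : R) :
  0 <= kappa -> (resolvent_norm A z <= B%:E)%E ->
  (forall i j, normc (A' i j - A i j) <= kappa) ->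
  normc (\det (z%:M - A')) <=
  normc (\det (z%:M - A)) * (1 + n%:R ^+ 2 * kappa * B) ^+ n.
Proof.
(* At an eigenvalue the norm is [+oo], contradicting the finite bound; hence [A - z] is invertible
   and [invmx] is its inverse. *)
move=> kappa0; rewrite /resolvent_norm; case: ifP => // eigA; rewrite lee_fin => RB AA'.
have uA : A - z%:M \in unitmx.
  by rewrite -row_free_unit -kermx_eq0; move/negbT: eigA; rewrite negbK.
set Q := invmx (A - z%:M) in RB *.
have -> : z%:M - A' = (z%:M - A) *m (1%:M + Q *m (A' - A)).
  rewrite mulmxDr mulmx1 mulmxA -[z%:M - A]opprB mulNmx mulmxV // mulNmx mul1mx.
  by rewrite !opprB addrA subrK.
rewrite det_mulmx normcM ler_wpM2l ?normc_ge0 //.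
apply: (le_trans (normc_det_le _)).
rewrite -[X in _ ^+ X](card_ord n) -prodr_const ler_prod // => i _.
rewrite sumr_ge0 => [/=|j _]; last exact: normc_ge0.
apply: (@le_trans _ _ (\sum_j ((i == j)%:R + n%:R * kappa * B))).
  apply: ler_sum => j _; rewrite !mxE; apply: (le_trans (normc_triangle _ _)).
  rewrite lerD //; first by rewrite -(rmorph_nat (real_complex R)) normc_real ger0_norm.
  apply: (le_trans (normc_sum _ _ _)).
  rewrite -mulrA mulr_natl -[X in _ *+ X](card_ord n) -sumr_const; apply: ler_sum => k _.
  rewrite normcM mulrC ler_pM ?normc_ge0 //; first by rewrite !mxE.
  exact: le_trans (normc_entry_le_opnorm _ _ _) RB.
rewrite big_split /= (bigD1 i) //= eqxx big1 ?addr0 => [|j ji]; last by rewrite eq_sym (negPf ji).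
by rewrite sumr_const card_ord -[_ *+ n]mulr_natl !mulrA expr2.
Qed.

End determinant.

(** * Dependence of the CMV box on its coefficients and on the phase *)

Section cmv_perturbation.
Context {R : realType}.

Lemma sqrt_sub_le (a b : R) : 0 <= a -> 0 <= b ->
  `|Num.sqrt a - Num.sqrt b| <= Num.sqrt `|a - b|.
Proof.
have h (u v : R) : 0 <= v -> v <= u -> Num.sqrt u - Num.sqrt v <= Num.sqrt (u - v).
  move=> v0 vu; rewrite lerBlDr.
  have s0 : 0 <= Num.sqrt (u - v) + Num.sqrt v by rewrite addr_ge0 ?sqrtr_ge0.
  rewrite -[leRHS]ger0_norm // -sqrtr_sqr ler_wsqrtr // sqrrD !sqr_sqrtr ?subr_ge0 //.
  have : 0 <= Num.sqrt (u - v) * Num.sqrt v by rewrite mulr_ge0 ?sqrtr_ge0.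
  lra.
move=> a0 b0; have [ab|/ltW ba] := leP a b.
  by rewrite distrC [X in _ <= Num.sqrt X]distrC !ger0_norm ?subr_ge0 ?ler_wsqrtr ?h.
by rewrite !ger0_norm ?subr_ge0 ?ler_wsqrtr ?h.
Qed.

Lemma Theta_sum_bound (s : int) (a : int -> R[i]) (r : int -> R) (c : R) i k :
  0 <= c -> (forall m, normc (a m) <= c) -> (forall m, `|r m| <= c) ->
  normc (Theta_sum s a r i k) <= c.
Proof.
move=> c0 ac rc; rewrite /Theta_sum; case: ifP => _; last by rewrite normc0.
rewrite /Theta /mx2 mxE; do 2 case: ifP => _.
- by rewrite normc_conj.
- by rewrite normc_real.
- by rewrite normc_real.
- by rewrite normc_opp.
Qed.

(** Additivity in the coefficients lets [Theta_sum_bound] serve for entries, with bound 1, and for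
    their differences, with bound [kappa]. *)
Lemma Theta_sumB (s : int) (a a' : int -> R[i]) (r r' : int -> R) i k :
  Theta_sum s a r i k - Theta_sum s a' r' i k =
  Theta_sum s (fun m => a m - a' m) (fun m => r m - r' m) i k.
Proof.
rewrite /Theta_sum; case: ifP => _; last by rewrite subrr.
rewrite /Theta /mx2 !mxE; do 2 case: ifP => _; rewrite ?rmorphB //.
by rewrite [RHS]opprD.
Qed.

(** Three intermediate indices, each contributing a product of two factors of modulus at most 1 that
    move by at most [kappa]: hence 6. *)
Lemma cmv_sub_le (a a' : int -> R[i]) (r r' : int -> R) (kappa : R) i j :
  0 <= kappa ->
  (forall m, normc (a m) <= 1) -> (forall m, `|r m| <= 1) ->
  (forall m, normc (a' m) <= 1) -> (forall m, `|r' m| <= 1) ->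
  (forall m, normc (a m - a' m) <= kappa) -> (forall m, `|r m - r' m| <= kappa) ->
  normc (cmv a r i j - cmv a' r' i j) <= 6 * kappa.
Proof.
move=> k0 a1 r1 a'1 r'1 aa' rr'.
rewrite /cmv -sumrB; apply: (le_trans (normc_sum _ _ _)).
have step k : normc (Theta_sum 0 a r i k * Theta_sum 1 a r k j -
    Theta_sum 0 a' r' i k * Theta_sum 1 a' r' k j) <= 2 * kappa.
  rewrite [X in normc X](_ : _ =
    Theta_sum 0 a r i k * (Theta_sum 1 a r k j - Theta_sum 1 a' r' k j) +
    (Theta_sum 0 a r i k - Theta_sum 0 a' r' i k) * Theta_sum 1 a' r' k j); last ring.
  apply: (le_trans (normc_triangle _ _)); rewrite !normcM !Theta_sumB.
  rewrite (_ : 2 * kappa = 1 * kappa + kappa * 1); last ring.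
  by rewrite lerD // ler_pM ?normc_ge0 ?Theta_sum_bound.
rewrite !big_cons big_nil addr0.
have := step (i - 1); have := step i; have := step (i + 1); lra.
Qed.

Context (d : nat) (alpha : 'rV[R]_d -> R[i])
  (alpha_lt1 : forall x, normc (alpha x) < 1).

Lemma one_sub_sqr_normc_ge0 x : 0 <= 1 - normc (alpha x) ^+ 2.
Proof. by rewrite subr_ge0 expr_le1 ?normc_ge0 // ltW. Qed.

Lemma rho_bound x : 0 <= rho alpha x <= 1.
Proof.
rewrite /rho sqrtr_ge0 /= -[leRHS]sqrtr1 ler_wsqrtr //.
by rewrite lerBlDr lerDl sqr_ge0.
Qed.

(** The squared moduli differ by at most twice the change of [alpha], that is by [kappa ^+ 2], and
    the square root is Hoelder of exponent 1/2. *)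
Lemma rho_sub_le x y (kappa : R) : 0 <= kappa ->
  normc (alpha x - alpha y) <= kappa ^+ 2 / 2 -> `|rho alpha x - rho alpha y| <= kappa.
Proof.
move=> k0 xy; apply: (le_trans (sqrt_sub_le (one_sub_sqr_normc_ge0 x) (one_sub_sqr_normc_ge0 y))).
rewrite -[leRHS](ger0_norm k0) -[leRHS]sqrtr_sqr ler_wsqrtr //.
rewrite [X in `|X|](_ : _ = (normc (alpha y) - normc (alpha x)) *
  (normc (alpha y) + normc (alpha x))); last ring.
have s0 : 0 <= normc (alpha y) + normc (alpha x) by rewrite addr_ge0 ?normc_ge0.
rewrite normrM [X in _ * X]ger0_norm //.
rewrite [leRHS](_ : _ = kappa ^+ 2 / 2 * 2); last lra.
rewrite ler_pM // ?(le_trans (normc_dist _ _)) // 1?normc_distC //.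
by have := alpha_lt1 x; have := alpha_lt1 y; lra.
Qed.

Lemma cmv_box_sub_le (beta eta : R[i]) n (omega x y : 'rV[R]_d) (kappa : R) :
  0 <= kappa <= 1 -> normc beta = 1 -> normc eta = 1 ->
  (forall m : int, normc (alpha (x + m%:~R *: omega) -
                          alpha (y + m%:~R *: omega)) <= kappa ^+ 2 / 2) ->
  forall i j, normc (cmv_box alpha beta eta 0 n omega x i j -
                     cmv_box alpha beta eta 0 n omega y i j) <= 6 * kappa.
Proof.
move=> /andP[k0 k1] b1 e1 xy i j; rewrite /cmv_box !mxE.
have r01 w : `|rho alpha w| <= 1 by have /andP[? ?] := rho_bound w; rewrite ger0_norm.
apply: cmv_sub_le => // m.
- by case: ifP => _; [rewrite b1|case: ifP => _; [rewrite e1|exact: ltW]].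
- by case: ifP => _; rewrite ?normr0.
- by case: ifP => _; [rewrite b1|case: ifP => _; [rewrite e1|exact: ltW]].
- by case: ifP => _; rewrite ?normr0.
- case: ifP => _; [|case: ifP => _]; rewrite ?subrr ?normc0 //.
  (* As [kappa <= 1], the bound [kappa ^+ 2 / 2] needed for [rho] also controls [alpha]. *)
  by rewrite (le_trans (xy m)) //; nra.
- case: ifP => _; first by rewrite subrr normr0.
  exact: rho_sub_le.
Qed.

End cmv_perturbation.

(** * Growth comparisons for large [n] *)

Section asymptotics.
Context {R : realType}.

Lemma le_powR_near_infty (e M : R) : 0 < e ->
  exists N : nat, forall n, (N <= n)%N -> M <= n%:R `^ e.
Proof.
move=> e0; pose M' := `|M| + 1.
have M'1 : 1 <= M' by rewrite lerDr.
have [N _ HN] := nbhs_infty_ger (M' `^ e^-1).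
exists N => n /HN /= Mn.
apply: (@le_trans _ _ M'); first by rewrite (le_trans (ler_norm M)) // lerDl.
have -> : M' = (M' `^ e^-1) `^ e.
  by rewrite -powRrM mulVf ?gt_eqF // powRr1 // (le_trans ler01).
by apply: ge0_ler_powR; rewrite ?nnegrE ?powR_ge0 ?ler0n //; exact: ltW.
Qed.

(* With [u = n^(nu/2)] every factor except [expR (- c u^2)] is at most the
   exponential of a linear function of [u]. *)
Lemma expR_quadratic_decay (K c nu : R) : 0 < c -> 0 < nu ->
  exists N : nat, forall n, (N <= n)%N ->
    n%:R ^+ 3 * K * expR (- (c * (n%:R `^ (nu / 2)) ^+ 2)) * expR (n%:R `^ (nu / 2))
      <= 1.
Proof.
move=> c0 nu0; pose a := 2 / nu; have a0 : 0 < a by rewrite divr_gt0.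
(* Linear rates in [u]: [3 * a] from [n ^+ 3], since [n = u ^ a <= expR (a * u)], then [K], then
   [expR u]. Once [u >= B / c], the quadratic term wins; [u >= 1] turns the constant [|K|] into a
   linear term. *)
pose B := 3 * a + `|K| + 1.
have [N HN] := @le_powR_near_infty (nu / 2) (1 + B / c) (divr_gt0 nu0 (ltr0n _ 2)).
exists N.+1 => n Nn.
have n0 : (0 : R) < n%:R by rewrite ltr0n (leq_trans _ Nn).
have := HN n (ltnW Nn); set u := _ `^ _ => Mu.
have B0 : 0 < B by rewrite /B; have := normr_ge0 K; lra.
have Bc0 : 0 < B / c by rewrite divr_gt0.
have u1 : 1 <= u by rewrite (le_trans _ Mu) // lerDl ltW.
have u0 : 0 < u by lra.
have nu_ : n%:R = u `^ a.
  rewrite /u -powRrM (_ : nu / 2 * a = 1) ?powRr1 ?ltW //.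
  by rewrite /a; field; rewrite gt_eqF.
have n_le : n%:R <= expR (a * u).
  rewrite -[leLHS](@lnK _ n%:R) ?posrE // ler_expR nu_ ln_powR ler_wpM2l ?ltW //.
  exact: ln_sublinear.
have K_le : K <= expR `|K|.
  rewrite (le_trans (ler_norm K)) // (le_trans _ (expR_ge1Dx _)) //.
  by rewrite lerDr.
apply: (@le_trans _ _ (expR (3%:R * (a * u)) * expR `|K| * expR (- (c * u ^+ 2)) * expR u)).
  rewrite !ler_wpM2r ?expR_ge0 //.
  apply: (le_trans (ler_wpM2l _ K_le)); first by rewrite exprn_ge0 // ltW.
  by rewrite ler_wpM2r ?expR_ge0 // expRM_natl lerXn2r ?nnegrE ?expR_ge0 ?ler0n.
rewrite -!expRD expR_le1.
have Bu : B * u <= c * u ^+ 2.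
  rewrite expr2 mulrA ler_wpM2r ?(ltW u0) // mulrC -ler_pdivrMr //.
  by rewrite (le_trans _ Mu) // lerDr.
have : `|K| <= `|K| * u by rewrite ler_peMr.
by move: Bu; rewrite /B; lra.
Qed.

(** As soon as the factor [n ^ (tau / 2)] reaches 3, the right side is at least three times
    [n ^ (1 - tau)], which is itself at least 1. *)
Lemma powR_gap (tau : R) : 0 < tau < 1 ->
  exists N : nat, forall n, (N <= n)%N ->
    n%:R `^ (1 - tau) + 1 < (n%:R : R) `^ (1 - tau / 2).
Proof.
move=> /andP[tau0 tau1].
have [N HN] := @le_powR_near_infty (tau / 2) 3 (divr_gt0 tau0 (ltr0n _ 2)).
exists N.+1 => n Nn.
have n1 : (1 : R) <= n%:R by rewrite ler1n (leq_trans _ Nn).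
have -> : 1 - tau / 2 = (1 - tau) + tau / 2 by field.
rewrite (@powRD _ _ (1 - tau) (tau / 2)); last first.
  by apply/implyP => _; rewrite gt_eqF // (lt_le_trans ltr01).
have h3 := HN n (ltnW Nn).
have h1 : 1 <= n%:R `^ (1 - tau).
  by have := @ler_powR _ _ n1 0 (1 - tau); rewrite powRr0; apply; rewrite subr_ge0 ltW.
have : n%:R `^ (1 - tau) * 3 <= n%:R `^ (1 - tau) * n%:R `^ (tau / 2).
  by rewrite ler_wpM2l // (le_trans ler01).
by lra.
Qed.

End asymptotics.

(** * Transfer of the lower bound from a nearby non-exceptional phase *)

Theorem lemma3p22 (R : realType) (d : nat) (h : R) (alpha : 'rV[R]_d -> R[i])
    (d_gt1 : (1 < d)%N) (h_gt0 : 0 < h) (alphaP : sampling_function h alpha) :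
  exists C : R, 0 < C /\
  forall (p q gamma tau nu : R) (z : R[i]),
    0 < p -> d%:R < q -> 0 < gamma -> normc z = 1 ->
    LDT_exponents alpha p q gamma z tau nu ->
  exists N : nat,
  forall (beta eta : R[i]) (x omega : 'rV[R]_d),
    normc beta = 1 -> normc eta = 1 ->
    diophantine p q omega -> gamma < lyapunov alpha omega z ->
  forall n : nat, (N <= n)%N ->
    (resolvent_norm (cmv_box alpha beta eta 0 n omega x) z
       <= (C * expR (n%:R `^ (nu / 2)))%:E)%E ->
    ((n%:R * Ln alpha omega z n - n%:R `^ (1 - tau / 2))%:E
       < lne (normc (phi alpha beta eta 0 n omega z x))%:E)%E.
Proof.
(* Here [a] and [b] stand for the logarithms at [x] and [y], [m] for [n L_n], and [t], [g] for the
   two error terms. *)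
have final (a b g m t : R) : t + 1 < g -> b <= a + 1 -> - t <= b - m -> m - g < a.
  by lra.
have [alphaper alpha1 _ alphaan] := alphaP.
have [r [L [r0 L0 alphaL]]] := analytic_extension_lipschitz h_gt0 alphaan alphaper.
exists 1; split=> // p q gamma tau nu z _ _ _ _.
move=> [tau01 /andP[nu0 _] [C0 [N0 [C00 LDT]]] _].
(* Chosen so that [s = expR (- (c * u ^+ 2))] and [delta = s ^+ 2] make [delta ^+ d] exactly the
   large deviation bound, as [u ^+ 2 = n ^ nu]. *)
pose c := C0 / (2 * d%:R).
have d0 : (0 : R) < d%:R by rewrite ltr0n ltnW.
have c0 : 0 < c by rewrite divr_gt0 // mulr_gt0.
(* With [kappa = K * s], the first two summands give [L * delta <= kappa ^+ 2 / 2], the 2 gives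
   [delta <= 2^-1], and [r^-1] gives [delta <= r]. *)
pose K := 2 * L + 2 + r^-1.
have r'0 : 0 < r^-1 by rewrite invr_gt0.
have [N1 HN1] := expR_quadratic_decay (6 * K) c0 nu0.
have [N2 HN2] := powR_gap tau01.
exists (maxn N0 (maxn N1 N2)).+1 => beta eta x omega beta1 eta1 dio lyap n.
move=> Nn; rewrite mul1r => resx.
have n0 : (0 < n)%N := leq_ltn_trans (leq0n _) Nn.
move: (ltnW Nn); rewrite !geq_max => /and3P[nN0 nN1 nN2].
have n1 : (1 : R) <= n%:R by rewrite ler1n.
have := HN1 n nN1; have := HN2 n nN2.
set u := n%:R `^ (nu / 2) in resx * => gap decay.
pose s := expR (- (c * u ^+ 2)).
have s0 : 0 < s := expR_gt0 _.
have decay' : n%:R ^+ 3 * (6 * (K * s)) * expR u <= 1.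
  by move: decay; rewrite -/s !mulrA.
pose kappa := K * s; pose delta := s ^+ 2.
have K0 : 0 < K by rewrite /K; lra.
have kappa0 : 0 < kappa by rewrite mulr_gt0.
have kappa6 : 6 * kappa <= 1.
  have u1 : 1 <= expR u by rewrite -expR0 ler_expR powR_ge0.
  have k60 : 0 <= 6 * kappa by rewrite mulr_ge0 // ltW.
  apply: le_trans decay'; apply: (@le_trans _ _ (n%:R ^+ 3 * (6 * kappa))).
    by rewrite ler_peMl // exprn_ege1.
  by rewrite ler_peMr // mulr_ge0 // exprn_ge0.
have sK2 : 2 * s <= kappa by rewrite /kappa ler_wpM2r ?ltW // /K; lra.
have sKr : r^-1 * s <= kappa by rewrite /kappa ler_wpM2r ?ltW // /K; lra.
have delta_s : delta <= s by rewrite /delta expr2 ler_piMl ?ltW //; lra.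
have delta0 : 0 <= delta by rewrite sqr_ge0.
have delta_r : delta <= r.
  apply: (le_trans delta_s); rewrite -(@ler_pM2l _ r^-1) // mulVf ?gt_eqF //; lra.
have Ldelta : L * delta <= kappa ^+ 2 / 2.
  have KL : 2 * L <= K ^+ 2.
    have hK : 2 * L + 2 <= K by rewrite /K; lra.
    by nra.
  rewrite /kappa exprMn -/delta mulrAC ler_wpM2r //; lra.
(* The good phase [y] is sought near [x + k] in the unit cube; periodicity of [alpha] brings the
   comparison back to [x]. *)
have [k x01] := periodic_unit_cube x.
pose A := [set y | ((n%:R `^ (1 - tau))%:E <
  `| lne (normc (phi alpha beta eta 0 n omega z y))%:E
     - (n%:R * Ln alpha omega z n)%:E |)%E].
have Adelta : (mes A < (delta ^+ d)%:E)%E.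
  have -> : delta ^+ d = expR (- (C0 * n%:R `^ nu)).
    rewrite /delta /s -exprM -expRM_natl; congr expR.
    have -> : n%:R `^ nu = u ^+ 2.
      rewrite /u -powR_mulrn ?powR_ge0 // -powRrM; congr (_ `^ _); lra.
    rewrite natrM /c; field.
    by rewrite gt_eqF.
  exact: (LDT omega beta eta dio lyap beta1 eta1 n nN0).
have delta01 : 0 <= delta <= 2^-1 by rewrite delta0 /=; lra.
have [y [Ay xy]] := exists_near_notin delta01 x01 Adelta.
have box := @cmv_box_sub_le _ _ alpha alpha1 beta eta n omega y x kappa.
have {}box i j : normc (cmv_box alpha beta eta 0 n omega y i j -
    cmv_box alpha beta eta 0 n omega x i j) <= 6 * kappa.
  apply: box => // [|m]; first by rewrite (ltW kappa0) /=; lra.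
  rewrite -(alphaper (x + m%:~R *: omega) k); apply: le_trans Ldelta.
  apply: alphaL; first by rewrite delta0.
  move=> l; have := xy l; rewrite distrC !mxE.
  by congr (`|_| <= _); ring.
have det_le := det_resolvent_perturb (mulr_ge0 (ler0n _ 6) (ltW kappa0)) resx box.
have phi_le : normc (phi alpha beta eta 0 n omega z y) <=
    normc (phi alpha beta eta 0 n omega z x) * expR 1.
  apply: (le_trans det_le); rewrite ler_wpM2l ?normc_ge0 //.
  set w := _ * expR u.
  have w0 : 0 <= w
    by rewrite /w mulr_ge0 ?expR_ge0 // mulr_ge0 ?exprn_ge0 // mulr_ge0 // ltW.
  (* [(1 + w) ^+ n <= expR (n * w)], and [n * w] is the quantity in [decay']: two powers of [n] come
     from the row sums, the third from the determinant. *)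
  apply: (@le_trans _ _ (expR w ^+ n)).
    by apply: lerXn2r; rewrite ?nnegrE ?expR_ge0 ?addr_ge0 //; exact: expR_ge1Dx.
  rewrite -expRM_natl ler_expR; apply: le_trans decay'.
  by rewrite le_eqVlt; apply/orP; left; apply/eqP; rewrite /w /kappa; ring.
(* A zero at [y] has [lne] equal to [-oo], which would put [y] in the exceptional set; so the
   determinant is nonzero at [y], and by [phi_le] at [x]. *)
have [phiy0|phiy0] := eqVneq (normc (phi alpha beta eta 0 n omega z y)) 0.
  by case: Ay; rewrite /A /mkset phiy0 le0_lneNy //= ltry.
have {}phiy0 : 0 < normc (phi alpha beta eta 0 n omega z y).
  by rewrite lt_def phiy0 normc_ge0.
have phix0 : 0 < normc (phi alpha beta eta 0 n omega z x).
  by rewrite -(pmulr_lgt0 _ (expR_gt0 1)) (lt_le_trans phiy0).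
have {}phi_le : ln (normc (phi alpha beta eta 0 n omega z y)) <=
    ln (normc (phi alpha beta eta 0 n omega z x)) + 1.
  rewrite -[1 in leRHS](expRK 1) -lnM ?posrE ?expR_gt0 //.
  rewrite ler_ln ?posrE; [exact: phi_le|exact: phiy0|].
  exact: mulr_gt0 phix0 (expR_gt0 1).
rewrite (lne_EFin phix0) lte_fin.
move: Ay; rewrite /A /mkset (lne_EFin phiy0) -EFinB /= lte_fin => /negP; rewrite -leNgt.
rewrite ler_norml => /andP[lower _].
exact: final gap phi_le lower.
Qed.
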